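(* Let $d$ be a non-negative integer, let $B\subseteq\mathbb{R}^d$ be a finite Ramsey set, and let $z\in\mathbb{R}^d$ be a vector with $z\notin\operatorname{aff}(B)$. Then $B\cup\{z\}$ is Ramsey.
   Context: All Euclidean spaces $\mathbb{R}^n$ carry the standard Euclidean distance. For $S\subseteq\mathbb{R}^d$, $\operatorname{aff}(S)$ denotes the affine hull of $S$, i.e. the set of all affine combinations of vectors in $S$. A congruent copy of a set $S$ in a Euclidean space is a set $S'$ in a (possibly different) Euclidean space for which there is a bijection $\varphi:S\to S'$ preserving all pairwise distances. For an integer $r\ge 1$, an $r$-colouring of $\mathbb{R}^n$ is an arbitrary function from $\mathbb{R}^n$ to a set of $r$ colours; a subset is monochromatic if all its points receive the same colour. A finite set $T$ in a Euclidean space is called Ramsey if, for every integer $r\ge 1$, there is an integer $n$ (allowed to depend on $r$ and $T$) such that every $r$-colouring of $\mathbb{R}^n$ contains a monochromatic congruent copy of $T$. *)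

(* Defs.v *)
From mathcomp Require Import all_boot all_order all_algebra.
From mathcomp Require Import classical_sets functions cardinality reals.

Set Implicit Arguments.
Unset Strict Implicit.
Unset Printing Implicit Defensive.

Import Order.TTheory GRing.Theory Num.Theory.

Local Open Scope classical_set_scope.
Local Open Scope ring_scope.

(* Euclidean space R^n is 'rV[R]_n. The norm that mathcomp-analysis puts on
   matrices is the sup norm, so the Euclidean distance is defined here. *)
Definition edist (R : realType) (n : nat) (x y : 'rV[R]_n) : R :=
  Num.sqrt (\sum_(i < n) (x 0 i - y 0 i) ^+ 2).

(* The points p i need not be distinct; m = 0 is excluded by the condition that
   the coefficients sum to 1, so the affine hull of the empty set is empty. *)
Definition aff (R : realType) (d : nat) (S : set 'rV[R]_d) : set 'rV[R]_d :=
  [set v | exists (m : nat) (p : 'I_m -> 'rV[R]_d) (c : 'I_m -> R),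
    [/\ forall i, S (p i), \sum_(i < m) c i = 1 & v = \sum_(i < m) c i *: p i]].

(* phi is total, but only its restriction to S matters. *)
Definition congruent_copy (R : realType) (m n : nat)
    (S : set 'rV[R]_m) (S' : set 'rV[R]_n) : Prop :=
  exists phi : 'rV[R]_m -> 'rV[R]_n,
    set_bij S S' phi /\
    forall x y, S x -> S y -> edist (phi x) (phi y) = edist x y.

Definition monochromatic (T C : Type) (chi : T -> C) (S : set T) : Prop :=
  forall x y, S x -> S y -> chi x = chi y.

Definition Ramsey (R : realType) (d : nat) (T : set 'rV[R]_d) : Prop :=
  finite_set T /\
  forall r : nat, (1 <= r)%N ->
    exists n : nat, forall chi : 'rV[R]_n -> 'I_r,
      exists T' : set 'rV[R]_n, congruent_copy T T' /\ monochromatic chi T'.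

(* Main.v *)
Require Import Defs.
From mathcomp Require Import all_boot all_order all_algebra.
From mathcomp Require Import ring lra zify.
From mathcomp Require Import boolp classical_sets functions cardinality reals.
From mathcomp Require Import filter.

Set Implicit Arguments.
Unset Strict Implicit.
Unset Printing Implicit Defensive.

Import Order.TTheory GRing.Theory Num.Theory.

Local Open Scope classical_set_scope.
Local Open Scope ring_scope.

(** Write z = z0 + w with w orthogonal to the differences of points of B and
    |w| = h > 0, so that |b - z|^2 = |b - z0|^2 + h^2 for every b in B. The
    proof is an induction on the number of colours. Suppose that a finite
    set X forces a monochromatic copy of B with z under r colours. Move each
    x in X by h along a private new unit vector e_x, and put over the
    resulting point p_x = x + h e_x a copy of B, placed in fresh dimensions,
    the same for all x, in which x itself gets the coordinates of z0. Then x
    is an apex over the copy of B at p_x. The union K of these copies is the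
    product P x B with P = {p_x}. If K is Ramsey, take a finite set forcing
    a monochromatic copy of K under r + 1 colours and attach a copy of X to
    each copy of K in it. Either some apex x has the colour of K, and B with
    z is found, or X misses that colour and the induction hypothesis applies
    to X.

    So K must be Ramsey. Products of Ramsey sets are Ramsey, hence it suffices
    to treat P, whose squared distances are |x - x'|^2 + 2 h^2 for x <> x'.
    Squared-distance functions of Ramsey configurations form a convex cone
    stable under pullback (the sum is the diagonal of a product), and two
    families generate enough of it:
    - cut functions, from two-point sets;
    - the functions |T^t a - T^t' a|^2, where T^t a is a fixed finitely
      supported word a shifted by t. These come from a Ramsey property of
      increasing words of integers, [monochromatic_windows]. For a long
      tent-shaped word they are nearly proportional to (t - t')^2, so that they
      give nearly collinear, equally spaced points.
    Summing over coordinates, x, x' |-> |x - x'|^2 is a limit of functions of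
    the cone. The surplus 2 h^2 of the distances of P absorbs the error of
    approximation, because the distance function of a regular simplex is
    interior to the cone generated by the cuts ([approx_regularize]).

    Two further facts carry the argument: a finite Ramsey set has finite
    witnesses ([Ramsey_dist_ramsey], by compactness), and an isometry between
    finite sets extends to the ambient spaces after dimensions are added
    ([isometry_extension]). *)

(** * Increasing words with monochromatic windows *)

(** The shift-graph part of Ramsey's theorem for (k+1)-subsets. It suffices here
    because only consecutive windows of one long increasing word are compared. For
    the induction on k, colour a shorter word w by the set of pairs (c, s)
    such that some increasing word beginning with w has its first s windows
    coloured c. If w and its successor w' get the same colour, and c is the
    colour of the window made of w and w', then runs of colour c starting at w'
    can be lengthened one window at a time. *)
Lemma monochromatic_windows (k : nat) : forall (C : finType) (S : nat), exists N : nat,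
  forall chi : seq nat -> C, exists (v : seq nat) (c : C),
    [/\ sorted ltn v, all (gtn N) v, size v = (k.+1 + S)%N &
        forall t, (t <= S)%N -> chi (take k.+1 (drop t v)) = c].
Proof.
elim: k => [|k IHk] C S.
  exists (#|C| * S).+1 => chi.
  (* One-letter windows: the pigeonhole principle. *)
  pose P c := [seq i <- iota 0 (#|C| * S).+1 | chi [:: i] == c].
  have [c hc] : exists c, (S < size (P c))%N.
    apply/existsP; apply: contraT; rewrite negb_exists => /forallP H.
    have : (\sum_(c : C) size (P c) <= #|C| * S)%N.
      rewrite -sum_nat_const; apply: leq_sum => c _.
      by have := H c; rewrite -leqNgt.
    under eq_bigr do rewrite size_filter -sum1_count.
    rewrite (exchange_big_dep predT) //=.
    have -> : (\sum_(j <- iota 0 (#|C| * S).+1) \sum_(i | chi [:: j] == i) 1)%N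
       = (#|C| * S).+1.
      rewrite (eq_bigr (fun=> 1%N)) ?sum1_size ?size_iota // => i _.
      by rewrite (big_pred1 (chi [:: i])) // => c; rewrite eq_sym.
    by rewrite ltnn.
  exists (take S.+1 (P c)), c; split.
  - apply: take_sorted; apply: (sorted_filter ltn_trans); exact: iota_ltn_sorted.
  - apply/allP => i /mem_take; rewrite mem_filter mem_iota => /andP[_] /=.
    by rewrite add0n.
  - by rewrite size_takel // add1n.
  - move=> t tS.
    have tP : (t < size (take S.+1 (P c)))%N by rewrite size_takel.
    rewrite (drop_nth 0%N tP) /= take0.
    have /mem_take := mem_nth 0%N tP.
    by rewrite mem_filter => /andP[/eqP].
have [N HN] := IHk {ffun C * 'I_S.+2 -> bool} 1%N.
exists N => chi.
pose good c s w := exists v : seq nat,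
    [/\ sorted ltn v, all (gtn N) v, size v = (k.+1 + s)%N, take k.+1 v = w &
        forall t, (t < s)%N -> chi (take k.+2 (drop t v)) = c].
have [v0 [g [sv0 av0 zv0 wv0]]] :=
  HN (fun w => [ffun cs : C * 'I_S.+2 => `[< good cs.1 cs.2 w >]]).
case: v0 sv0 av0 zv0 wv0 => [|x w'] // sv0 av0 zv0 wv0.
have zw' : size w' = k.+1 by move: zv0 => /=; lia.
have w'T : take k.+1 w' = w' by rewrite take_oversize ?zw'.
(* The two windows x :: take k w' and w' of v0 have the same colour g. *)
have wE : forall c s, (s < S.+2)%N -> good c s (x :: take k w') -> good c s w'.
  move=> c s hs.
  have e0 := wv0 0%N isT; have e1 := wv0 1%N isT.
  have /ffunP/(_ (c, Ordinal hs)) := etrans e0 (esym e1).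
  by rewrite !ffunE /= drop0 w'T => e /asboolT; rewrite e => /asboolW.
pose c := chi (x :: w').
have H s : (s < S.+2)%N -> good c s w'.
  elim: s => [|s IHs] hs.
    exists w'; split => //; first by move: sv0 => /path_sorted.
    - by case/andP: av0.
    - by rewrite addn0.
  (* Prepending x turns s windows from w' into s.+1 windows from w, and wE brings
     the run back to w'. *)
  apply: wE => //; have [v [sv av zv tv cv]] := IHs (ltnW hs).
  exists (x :: v); split.
  - move: sv sv0; rewrite -tv; case: v {zv av cv tv} => [|y v] //=.
    by move=> -> /andP[-> _].
  - by rewrite /= av andbT; case/andP: av0.
  - by rewrite /= zv; lia.
  - by rewrite /= -tv take_takel.
  - case=> [_|t ht]; last exact: cv.
    by rewrite drop0 [take _ _]/= tv.
have [v [sv av zv _ cv]] := H S.+1 (ltnSn _).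
exists v, c; split => //; first by rewrite zv; lia.
Qed.

(** * Squared distances *)

Definition sqdist (R : realType) (n : nat) (x y : 'rV[R]_n) : R :=
  \sum_(i < n) (x 0 i - y 0 i) ^+ 2.

Section SqDist.
Variable R : realType.

Lemma sqdistC n (x y : 'rV[R]_n) : sqdist x y = sqdist y x.
Proof. by apply: eq_bigr => i _; rewrite -sqrrN opprB. Qed.

Lemma sqdistxx n (x : 'rV[R]_n) : sqdist x x = 0.
Proof. by apply: big1 => i _; rewrite subrr expr0n. Qed.

Lemma sqdist_ge0 n (x y : 'rV[R]_n) : 0 <= sqdist x y.
Proof. by apply: sumr_ge0 => i _; exact: sqr_ge0. Qed.

Lemma sqdist_eq0 n (x y : 'rV[R]_n) : sqdist x y = 0 -> x = y.
Proof.
move/eqP; rewrite psumr_eq0 => [/allP H|i _]; last exact: sqr_ge0.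
apply/rowP => i; apply/eqP; rewrite -subr_eq0 -sqrf_eq0.
by apply: H; rewrite mem_index_enum.
Qed.

Lemma sqdist_row_mx m n (a a' : 'rV[R]_m) (b b' : 'rV[R]_n) :
  sqdist (row_mx a b) (row_mx a' b') = sqdist a a' + sqdist b b'.
Proof.
rewrite /sqdist big_split_ord /=; congr (_ + _); apply: eq_bigr => i _.
  by rewrite !row_mxEl.
by rewrite !row_mxEr.
Qed.

Lemma sqdistZ n c (x y : 'rV[R]_n) :
  sqdist (c *: x) (c *: y) = c ^+ 2 * sqdist x y.
Proof.
rewrite /sqdist mulr_sumr; apply: eq_bigr => i _.
by rewrite !mxE -mulrBr exprMn.
Qed.

Lemma sqdist_mulmx n (x y : 'rV[R]_n) :
  sqdist x y = ((x - y) *m (x - y)^T) 0 0.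
Proof. by rewrite mxE; apply: eq_bigr => i _; rewrite !mxE expr2. Qed.

End SqDist.

(** * The cone of Ramsey squared distances *)

(** Recording a configuration by its squared distances alone makes the Ramsey
    configurations on an index type I a subset of the vector space of functions
    on I x I, where sums and limits make sense. The witness Y is finite. *)
Definition dist_ramsey (R : realType) (I : finType) (D : I -> I -> R) : Prop :=
  forall C : finType, exists (n : nat) (J : finType) (Y : J -> 'rV[R]_n),
  forall chi : J -> C, exists s : I -> J,
    (forall i j, sqdist (Y (s i)) (Y (s j)) = D i j) /\
    (forall i j, chi (s i) = chi (s j)).

Section Cone.
Variable R : realType.
Implicit Types I J : finType.

Lemma eq_dist_ramsey I (D D' : I -> I -> R) :
  (forall i j, D i j = D' i j) -> dist_ramsey D -> dist_ramsey D'.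
Proof.
move=> eqD HD C; have [n [J [Y HY]]] := HD C; exists n, J, Y => chi.
by have [s [Ds ms]] := HY chi; exists s; split => // i j; rewrite Ds.
Qed.

Lemma dist_ramsey_sym I (D : I -> I -> R) i j : dist_ramsey D -> D i j = D j i.
Proof.
move=> /(_ unit)[n [J [Y]]] /(_ (fun=> tt))[s [Ds _]].
by rewrite -!Ds sqdistC.
Qed.

Lemma dist_ramsey_diag I (D : I -> I -> R) i : dist_ramsey D -> D i i = 0.
Proof.
move=> /(_ unit)[n [J [Y]]] /(_ (fun=> tt))[s [Ds _]].
by rewrite -Ds sqdistxx.
Qed.

Lemma dist_ramsey_pullback I I' (u : I' -> I) (D : I -> I -> R) :
  dist_ramsey D -> dist_ramsey (fun i j => D (u i) (u j)).
Proof.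
move=> HD C; have [n [J [Y HY]]] := HD C; exists n, J, Y => chi.
by have [s [Ds ms]] := HY chi; exists (s \o u); split => i j /=.
Qed.

Lemma dist_ramsey0 I : dist_ramsey (fun _ _ : I => 0 : R).
Proof.
move=> C; exists 0%N, unit, (fun=> 0) => chi; exists (fun=> tt); split => // i j.
by rewrite sqdistxx.
Qed.

Lemma dist_ramseyZ I c (D : I -> I -> R) :
  0 <= c -> dist_ramsey D -> dist_ramsey (fun i j => c * D i j).
Proof.
move=> c0 HD C; have [n [J [Y HY]]] := HD C.
exists n, J, (fun j => Num.sqrt c *: Y j) => chi.
have [s [Ds ms]] := HY chi; exists s; split => // i j.
by rewrite sqdistZ sqr_sqrtr // Ds.
Qed.

(** The product theorem, restricted to the diagonal: colour the second witness
    by the colourings that its points induce on the first one. *)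
Lemma dist_ramseyD I (D D' : I -> I -> R) :
  dist_ramsey D -> dist_ramsey D' -> dist_ramsey (fun i j => D i j + D' i j).
Proof.
move=> HD HD' C; have [n [J [Y HY]]] := HD C.
have [n' [J' [Y' HY']]] := HD' {ffun J -> C}.
exists (n + n')%N, (J * J')%type, (fun p => row_mx (Y p.1) (Y' p.2)) => chi.
have [s' [Ds' ms']] := HY' (fun j' => [ffun j => chi (j, j')]).
have [i0 _|I0] := pickP (@predT I); last first.
  have F : forall i : I, False by move=> i; have := I0 i.
  by exists (fun i => False_rect _ (F i)); split => i; case: (F i).
have [s [Ds ms]] := HY (fun j => chi (j, s' i0)).
exists (fun i => (s i, s' i)); split => i j.
  by rewrite sqdist_row_mx Ds Ds'.
have E k : chi (s k, s' k) = chi (s k, s' i0).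
  by have /ffunP/(_ (s k)) := ms' k i0; rewrite !ffunE.
by rewrite !E; exact: ms.
Qed.

Lemma dist_ramsey_sum I (K : finType) (P : pred K) (D : K -> I -> I -> R) :
  (forall k, P k -> dist_ramsey (D k)) ->
  dist_ramsey (fun i j => \sum_(k | P k) D k i j).
Proof.
move=> HD.
pose op (E E' : I -> I -> R) i j := E i j + E' i j.
have -> : (fun i j => \sum_(k | P k) D k i j) =
   \big[op/fun _ _ => 0]_(k | P k) D k.
  apply/funext => i; apply/funext => j.
  by elim/big_rec2: _ => // k E y _ ->.
apply: big_ind => //; first exact: dist_ramsey0.
by move=> E E'; exact: dist_ramseyD.
Qed.

(** A cut is pulled back from a two-point set, for which the vertices of a
    regular simplex with more vertices than colours are a witness. *)
Lemma dist_ramsey_cut I (A : pred I) :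
  dist_ramsey (fun i j => (A i != A j)%:R : R).
Proof.
suff H : dist_ramsey (fun b b' : bool => (b != b')%:R : R).
  exact: (dist_ramsey_pullback A H).
move=> C; pose n := #|C|.+1.
exists n, 'I_n, (fun k => Num.sqrt 2^-1 *: delta_mx 0 k) => chi.
have [k [l [kl ekl]]] : exists k l, k != l /\ chi k = chi l.
  have : ~~ injectiveb chi.
    apply/negP => /injectiveP/leq_card; by rewrite card_ord ltnn.
  case/injectivePn => k [l kl e]; by exists k, l.
have dkl : sqdist (Num.sqrt 2^-1 *: delta_mx 0 k : 'rV[R]_n)
                  (Num.sqrt 2^-1 *: delta_mx 0 l) = 1.
  rewrite sqdistZ sqr_sqrtr ?invr_ge0 // /sqdist.
  rewrite (bigD1 k) //= (bigD1 l) ?(eq_sym l) //= big1; last first.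
    move=> i /andP[/negPf ik /negPf il].
    by rewrite !mxE ik il subrr expr0n.
  by rewrite !mxE !eqxx (negPf kl) eq_sym (negPf kl) /=; field.
exists (fun b => if b then k else l); split.
  by case; case; rewrite ?sqdistxx //= ?dkl // sqdistC dkl.
by case; case; rewrite ?ekl.
Qed.

End Cone.

(** * Shifts of a word *)

Section Spread.
Variable R : realType.

(** Seen from index i = t + j, the word a placed at offset t is i |-> a (i - t);
    truncated subtraction is harmless since a 0 = 0. *)
Lemma sum_shift (a G : nat -> R) (k S t : nat) :
  a 0%N = 0 -> (forall j, (k < j)%N -> a j = 0) -> (t <= S)%N ->
  \sum_(i < k.+1 + S) a (i - t)%N * G i = \sum_(j < k.+1) a j * G (t + j)%N.
Proof.
move=> a0 ak tS.
rewrite -(big_mkord xpredT (fun i => a (i - t)%N * G i)).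
rewrite -(big_mkord xpredT (fun j => a j * G (t + j)%N)).
rewrite (big_cat_nat (n := t)) //=; last by lia.
rewrite [X in X + _]big_nat_cond big1 ?add0r; last first.
  move=> i /andP[/andP[_ it] _].
  by rewrite (_ : (i - t = 0)%N) ?a0 ?mul0r //; lia.
rewrite (big_cat_nat (n := (t + k.+1)%N)) //=; [|lia|lia].
rewrite [X in _ + X](_ : _ = 0) ?addr0; last first.
  rewrite big_nat_cond big1 // => i /andP[/andP[it _] _].
  by rewrite ak ?mul0r //; lia.
rewrite -{1}[t]add0n big_addn addKn; apply: eq_bigr => i _.
by rewrite addnK addnC.
Qed.

Lemma sum_sqr_inj m n (f : 'I_m -> 'I_n) (c : 'I_m -> R) : injective f ->
  \sum_p (\sum_i c i * (f i == p)%:R) ^+ 2 = \sum_i c i ^+ 2.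
Proof.
move=> f_inj.
have E p : (\sum_i c i * (f i == p)%:R) ^+ 2 = \sum_i c i ^+ 2 * (f i == p)%:R.
  have [i0 /eqP fi0|no] := pickP (fun i => f i == p); last first.
    by rewrite !big1 ?expr0n // => i _; rewrite no mulr0.
  rewrite (bigD1 i0) //= [RHS](bigD1 i0) //= fi0 eqxx !mulr1.
  have ne i : i != i0 -> (f i == p) = false.
    by move=> /negPf ii0; rewrite -fi0 (inj_eq f_inj).
  by rewrite !big1 ?addr0 // => i /ne ->; rewrite mulr0.
under eq_bigr do rewrite E.
rewrite exchange_big /=; apply: eq_bigr => i _.
rewrite (bigD1 (f i)) //= eqxx mulr1 big1 ?addr0 // => p /negPf.
by rewrite eq_sym => ->; rewrite mulr0.
Qed.

(** Attach to an increasing word g the vector with entries a 0, ..., a k at the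
    positions g 0 < ... < g k. Monochromatic windows of a long word v give shifts
    of one vector in the orthonormal system indexed by v. *)
Lemma dist_ramsey_spread (a : nat -> R) (k S : nat) :
  a 0%N = 0 -> (forall j, (k < j)%N -> a j = 0) ->
  dist_ramsey (fun t t' : 'I_S.+1 =>
    \sum_(i < k.+1 + S) (a (i - t)%N - a (i - t')%N) ^+ 2).
Proof.
move=> a0 ak C; have [N HN] := monochromatic_windows k C S.
pose Y (g : {ffun 'I_k.+1 -> 'I_N.+1}) : 'rV[R]_N.+1 :=
  \row_p \sum_(j < k.+1) a j * (g j == p)%:R.
exists N.+1, _, Y => chi.
have [v [c [sv av zv cv]]] :=
  HN (fun w => chi [ffun j : 'I_k.+1 => inord (nth 0%N w j)]).
pose f i : 'I_N.+1 := inord (nth 0%N v i).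
pose s (t : 'I_S.+1) := [ffun j : 'I_k.+1 => f (t + j)%N].
have chis t : chi (s t) = c.
  rewrite -(cv t); last by rewrite -ltnS.
  by congr chi; apply/ffunP => j; rewrite !ffunE nth_take // nth_drop.
exists s; split=> [t t'|t t']; last by rewrite !chis.
have vN (i : 'I_(k.+1 + S)) : (nth 0%N v i < N.+1)%N.
  by apply: ltnW; apply: (allP av); rewrite mem_nth // zv.
have f_inj : injective (fun i : 'I_(k.+1 + S) => f i).
  move=> i j /(congr1 val); rewrite /= !inordK //.
  move/eqP; rewrite nth_uniq ?zv //; first by move/eqP/val_inj.
  exact: (sorted_uniq ltn_trans ltnn).
have YE u p : Y (s u) 0 p = \sum_(i < k.+1 + S) a (i - u)%N * (f i == p)%:R.
  rewrite mxE (sum_shift (fun i => (f i == p)%:R) a0 ak); last by rewrite -ltnS.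
  by apply: eq_bigr => j _; rewrite ffunE.
rewrite -(sum_sqr_inj _ f_inj); apply: eq_bigr => p _.
by rewrite !YE -sumrB; congr (_ ^+ 2); apply: eq_bigr => i _; rewrite mulrBl.
Qed.

(** Both ends of the tent are 0, so a shift by s changes almost all of the 2 M
    entries by exactly s, and no entry by more. A ramp would not do: its final
    drop contributes a term of the order of M^2. *)
Definition tent M j : nat := minn j (2 * M - j).

Lemma sum_itv_le W a b : (\sum_(i < W) (a <= i < a + b) <= b)%N.
Proof.
rewrite -(big_mkord xpredT (fun i => (a <= i < a + b : nat)%N)).
rewrite -big_mkcond /= sum1_count -size_filter -[leqRHS](size_iota a).
apply: uniq_leq_size; first by rewrite filter_uniq // iota_uniq.
by move=> i; rewrite mem_filter mem_iota => /andP[].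
Qed.

Lemma tent_autocorrelation M S t t' : (t <= S)%N -> (t' <= S)%N ->
  `|\sum_(i < (2 * M).+1 + S) ((tent M (i - t))%:R - (tent M (i - t'))%:R) ^+ 2
    - (2 * M)%:R * (t%:R - t'%:R) ^+ 2| <= (2 * S).+1%:R * (t%:R - t'%:R) ^+ 2 :> R.
Proof.
move=> tS tS'; set W := ((2 * M).+1 + S)%N; set d := (t%:R - t'%:R) ^+ 2.
pose x i : R := ((tent M (i - t))%:R - (tent M (i - t'))%:R) ^+ 2.
rewrite -/(x _).
(* Indices i for which a corner of the tent can lie between i - t and i - t'. *)
pose bad i :=
  ((0 <= i < 0 + S) + ((M <= i < M + S) + (2 * M <= i < 2 * M + S.+1)))%N.
have d0 : 0 <= d by exact: sqr_ge0.
have [e eE dE] : exists2 e, e = ((t - t') + (t' - t))%N & d = e%:R ^+ 2.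
  eexists; first reflexivity.
  rewrite /d; have [h|/ltnW h] := leqP t t'; move: (h); rewrite -subn_eq0 => /eqP ->.
    by rewrite add0n natrB //; ring.
  by rewrite addn0 natrB.
have le_d i : x i <= d.
  rewrite /x dE; set u := tent _ _; set w := tent _ _.
  have [h1 h2] : (u <= w + e)%N /\ (w <= u + e)%N by rewrite /u /w eE /tent; lia.
  have {}h1 : u%:R <= w%:R + e%:R :> R by rewrite -natrD ler_nat.
  have {}h2 : w%:R <= u%:R + e%:R :> R by rewrite -natrD ler_nat.
  rewrite -subr_ge0.
  rewrite [X in 0 <= X](_ : _ = (w%:R + e%:R - u%:R) * (u%:R + e%:R - w%:R));
    last by ring.
  by apply: mulr_ge0; rewrite subr_ge0.
have ge_d i : (i < W)%N -> d - x i <= d * (bad i)%:R.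
  move=> iW; have [b0|b1] := posnP (bad i).
    rewrite b0 mulr0 /x dE; set u := tent _ _; set w := tent _ _.
    move/eqP: b0; rewrite /bad !addn_eq0 !eqb0 => /and3P[b1 b2 b3].
    have [->|->] : u = (w + e)%N \/ w = (u + e)%N.
      rewrite /u /w eE /tent; move: b1 b2 b3 iW; rewrite /W; lia.
    - by rewrite natrD addrAC subrr add0r subrr.
    - by rewrite natrD opprD addrA subrr add0r sqrrN subrr.
  apply: (@le_trans _ _ d); first by rewrite gerBl sqr_ge0.
  by rewrite ler_peMr // ler1n.
have bad_sum : (\sum_(i < W) bad i <= S + (S + S.+1))%N.
  rewrite !big_split; apply: leq_add; first exact: sum_itv_le.
  by apply: leq_add; exact: sum_itv_le.
have upper : \sum_(i < W) x i <= W%:R * d.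
  rewrite mulr_natl -[X in _ *+ X]card_ord -sumr_const.
  by apply: ler_sum => i _.
have lower : W%:R * d - \sum_(i < W) x i <= d * (S + (S + S.+1))%:R.
  rewrite mulr_natl -[X in _ *+ X]card_ord -sumr_const -sumrB.
  apply: (@le_trans _ _ (\sum_(i < W) d * (bad i)%:R)).
    by apply: ler_sum => i _; exact: ge_d.
  by rewrite -mulr_sumr -natr_sum ler_wpM2l // ler_nat.
have S0 : 0 <= S%:R * d by rewrite mulr_ge0.
have M1 : (2 * M)%:R = 2 * M%:R :> R by rewrite natrM.
move: upper lower; rewrite /W !natrD -!natr1 natrM => upper lower.
by rewrite ler_norml; apply/andP; split; nra.
Qed.

End Spread.

(** * Approximation by Ramsey distances *)

(** The closure of the cone of Ramsey squared distances. *)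
Definition approx_dist_ramsey (R : realType) (I : finType) (D : I -> I -> R) : Prop :=
  forall e : R, 0 < e -> exists E : I -> I -> R,
    dist_ramsey E /\ forall i j, `|D i j - E i j| <= e.

Section Approx.
Variables (R : realType) (I : finType).
Implicit Types (D E : I -> I -> R).

Lemma approx0 : approx_dist_ramsey (fun _ _ : I => 0 : R).
Proof.
move=> e e0; exists (fun _ _ => 0); split=> [|i j]; first exact: dist_ramsey0.
by rewrite subrr normr0 ltW.
Qed.

Lemma approxD D E : approx_dist_ramsey D -> approx_dist_ramsey E ->
  approx_dist_ramsey (fun i j => D i j + E i j).
Proof.
move=> HD HE e e0; have e20 : 0 < e / 2 by rewrite divr_gt0.
have [D' [rD dD]] := HD _ e20; have [E' [rE dE]] := HE _ e20.
exists (fun i j => D' i j + E' i j); split=> [|i j]; first exact: dist_ramseyD.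
rewrite opprD addrACA [leRHS]splitr.
by apply: le_trans (ler_normD _ _) _; exact: lerD.
Qed.

Lemma approx_sum (K : finType) (D : K -> I -> I -> R) :
  (forall k, approx_dist_ramsey (D k)) ->
  approx_dist_ramsey (fun i j => \sum_k D k i j).
Proof.
move=> HD.
pose op D E (i j : I) := D i j + E i j : R.
have -> : (fun i j => \sum_k D k i j) = \big[op/fun _ _ => 0]_k D k.
  apply/funext => i; apply/funext => j.
  by elim/big_rec2: _ => // k E y _ ->.
apply: big_ind => //; first exact: approx0.
by move=> D' E'; exact: approxD.
Qed.

Lemma approxZ c D : 0 <= c -> approx_dist_ramsey D ->
  approx_dist_ramsey (fun i j => c * D i j).
Proof.
move=> c0 HD e e0.
have c1 : 0 < c + 1 by rewrite ltr_wpDl.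
have [E [rE dE]] := HD _ (divr_gt0 e0 c1).
exists (fun i j => c * E i j); split=> [|i j]; first exact: dist_ramseyZ.
rewrite -mulrBr normrM ger0_norm //.
apply: (@le_trans _ _ ((c + 1) * (e / (c + 1)))); last first.
  by rewrite mulrC divfK // gt_eqF.
by apply: ler_pM => //; rewrite lerDl.
Qed.

Lemma approx_lim D :
  (forall e, 0 < e -> exists E,
     approx_dist_ramsey E /\ forall i j, `|D i j - E i j| <= e) ->
  approx_dist_ramsey D.
Proof.
move=> HD e e0; have e20 : 0 < e / 2 by rewrite divr_gt0.
have [E [aE dE]] := HD _ e20; have [F [rF dF]] := aE _ e20.
exists F; split=> // i j; rewrite -(subrKA (E i j)) [leRHS]splitr.
by apply: le_trans (ler_normD _ _) _; exact: lerD.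
Qed.

(** Shifts of a tent of width 2 M, rescaled by 1 / (2 M): the relative error is
    of the order of 1 / M. *)
Lemma approx_sqr_nat (t : I -> nat) :
  approx_dist_ramsey (fun i j => ((t i)%:R - (t j)%:R) ^+ 2 : R).
Proof.
move=> e e0.
pose S : nat := (\sum_i t i)%N.
have tS i : (t i <= S)%N by rewrite /S (bigD1 i) //= leq_addr.
pose K : R := (2 * S).+1%:R * S%:R ^+ 2.
pose M := (Num.truncn (K / e)).+1.
pose c : R := (2 * M)%:R^-1.
have M0 : 0 < (2 * M)%:R :> R by rewrite ltr0n muln_gt0.
exists (fun i j => c * \sum_(k < (2 * M).+1 + S)
  ((tent M (k - t i))%:R - (tent M (k - t j))%:R) ^+ 2); split=> [|i j].
  apply: dist_ramseyZ; first by rewrite invr_ge0 ltW.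
  have a0 : (tent M 0)%:R = 0 :> R by rewrite /tent min0n.
  have aM j : (2 * M < j)%N -> (tent M j)%:R = 0 :> R.
    by move=> Mj; rewrite /tent (_ : (minn _ _ = 0)%N) //; lia.
  have := dist_ramsey_pullback (fun i => inord (t i) : 'I_S.+1)
    (@dist_ramsey_spread R (fun j => (tent M j)%:R) (2 * M) S a0 aM).
  by apply: eq_dist_ramsey => i j; rewrite !inordK ?ltnS.
have := tent_autocorrelation R M (tS i) (tS j).
set X := \sum_(k < _) _; set d := (_ - _) ^+ 2 => H.
have -> : d - c * X = - c * (X - (2 * M)%:R * d).
  by rewrite /c; field; rewrite gt_eqF.
rewrite normrM normrN (@ger0_norm _ c) ?invr_ge0 // /c mulrC ler_pdivrMr //.
apply: le_trans H _.
have dS : d <= S%:R ^+ 2.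
  rewrite /d -ler_sqrt ?sqr_ge0 // !sqrtr_sqr (ger0_norm (ler0n _ _)).
  have := tS i; have := tS j; rewrite -!(ler_nat R) => h1 h2.
  have := ler0n R (t i); have := ler0n R (t j).
  by rewrite ler_norml; move=> *; apply/andP; split; lra.
apply: (@le_trans _ _ K); first by rewrite ler_wpM2l.
have /ltW : K / e < M%:R by apply: truncnS_gt.
rewrite ler_pdivrMr // natrM => H; nra.
Qed.

(** Round the reals u i, translated to be nonnegative, to multiples of 1 / N. *)
Lemma approx_sqr (u : I -> R) :
  approx_dist_ramsey (fun i j => (u i - u j) ^+ 2).
Proof.
pose B := \sum_i `|u i|.
have uB i : `|u i| <= B.
  by rewrite /B (bigD1 i) //= lerDl sumr_ge0.
apply: approx_lim => e e0.
pose N := (Num.truncn ((4 * B + 1) / e)).+1.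
have N0 : 0 < N%:R :> R by rewrite ltr0n.
have N1 : 1 <= N%:R :> R by rewrite ler1n.
have NB : 4 * B + 1 <= e * N%:R.
  by rewrite [leRHS]mulrC -ler_pdivrMr // ltW //; apply: truncnS_gt.
pose t i := Num.truncn (N%:R * (u i + B)).
exists (fun i j => N%:R ^- 2 * ((t i)%:R - (t j)%:R) ^+ 2); split=> [|i j].
  by apply: approxZ; [rewrite invr_ge0 exprn_ge0|exact: approx_sqr_nat].
have tE k : exists r, 0 <= r <= 1 /\ (t k)%:R = N%:R * (u k + B) - r.
  have /truncn_itv : 0 <= N%:R * (u k + B).
    rewrite mulr_ge0 // -lerBlDr sub0r.
    by have := uB k; rewrite ler_norml => /andP[].
  rewrite -/(t k) -natr1 => /andP[h1 h2].
  exists (N%:R * (u k + B) - (t k)%:R); split; last by ring.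
  by apply/andP; split; lra.
have [r [/andP[r0 r1] ->]] := tE i; have [q [/andP[q0 q1] ->]] := tE j.
pose x := u i - u j.
have -> : (u i - u j) ^+ 2 - N%:R ^- 2 *
    (N%:R * (u i + B) - r - (N%:R * (u j + B) - q)) ^+ 2
    = (r - q) * (2 * x - (r - q) / N%:R) / N%:R.
  by rewrite /x; field; rewrite gt_eqF.
rewrite normrM normfV (ger0_norm (ler0n _ _)) ler_pdivrMr //.
apply: le_trans NB; rewrite normrM -[leRHS]mul1r.
apply: ler_pM => //; first by rewrite ler_norml; apply/andP; split; lra.
apply: le_trans (ler_normB _ _) _; apply: lerD.
  rewrite normrM (ger0_norm (ler0n _ 2)).
  have := ler_normB (u i) (u j); have := uB i; have := uB j; rewrite -/x; lra.
rewrite normrM normfV (ger0_norm (ler0n _ _)) ler_pdivrMr // mul1r.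
by apply: le_trans N1; rewrite ler_norml; apply/andP; split; lra.
Qed.

Lemma sum_delta (F : I -> R) i : \sum_a F a * (a == i)%:R = F i.
Proof.
by rewrite (bigD1 i) //= eqxx mulr1 big1 ?addr0 // => a /negPf ->; rewrite mulr0.
Qed.

(** The error D - E is corrected by cuts. With G = h + D - E off the diagonal,
    and G within e of h, look for weights g on the cuts by ordered pairs {a, b}
    and s on the cuts by points {a}. Their sum at i <> j is
    2 r i + 2 r j - 4 g i j + s i + s j, where r i is the sum of the g i b.
    Choosing s so that 2 r i + s i = (h + e) / 2 for all i leaves
    g i j = (h + e - G i j) / 4, which lies in [0, e / 2]; so s is nonnegative
    as soon as e is small compared with h / #|I|. *)
Lemma approx_regularize D h : 0 < h -> approx_dist_ramsey D ->
  (forall i, D i i = 0) -> (forall i j, D i j = D j i) ->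
  dist_ramsey (fun i j => D i j + h * (i != j)%:R).
Proof.
move=> h0 HD D0 Dsym.
pose e := h / (2 * #|I|.+1%:R).
have e0 : 0 < e by rewrite divr_gt0 // mulr_gt0.
have [E [rE dE]] := HD _ e0.
have E0 i : E i i = 0 by exact: dist_ramsey_diag.
have Esym i j : E i j = E j i by exact: dist_ramsey_sym.
pose g i j := if i == j then 0 else (e - (D i j - E i j)) / 4.
have gsym i j : g i j = g j i by rewrite /g eq_sym Dsym Esym.
have g_ge0 i j : 0 <= g i j.
  rewrite /g; case: eqP => // _.
  by have := dE i j; rewrite ler_norml => /andP[]; lra.
have g_le i j : g i j <= e / 2.
  rewrite /g; case: eqP => [_|_]; first by rewrite divr_ge0 // ltW.
  by have := dE i j; rewrite ler_norml => /andP[]; lra.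
pose r i := \sum_b g i b.
pose s i := (h + e) / 2 - 2 * r i.
have s_ge0 i : 0 <= s i.
  have : r i <= #|I|%:R * (e / 2).
    by rewrite mulr_natl -sumr_const; apply: ler_sum.
  have : (2 * #|I|.+1%:R) * e = h by rewrite /e mulrC divfK // gt_eqF // mulr_gt0.
  rewrite -[#|I|.+1%:R]natr1 /s; set n := #|I|%:R => h1 h2.
  by have := ler0n R #|I|; rewrite -/n => n0; nra.
pose cut2 a b := [pred x : I | (x == a) || (x == b)].
have key : dist_ramsey (fun i j => E i j +
    (\sum_(p : I * I) g p.1 p.2 * (cut2 p.1 p.2 i != cut2 p.1 p.2 j)%:R +
     \sum_a s a * ((i == a) != (j == a))%:R)).
  apply: dist_ramseyD => //; apply: dist_ramseyD.
    by apply: dist_ramsey_sum => p _; apply: dist_ramseyZ => //; exact: dist_ramsey_cut.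
  apply: dist_ramsey_sum => a _; apply: dist_ramseyZ => //.
  exact: (dist_ramsey_cut R (pred1 a)).
apply: eq_dist_ramsey key => i j.
have [<-|ij] := eqVneq i j.
  rewrite E0 D0 !big1 ?mulr0 ?addr0 // => k _; by rewrite eqxx mulr0.
rewrite mulr1.
have -> : \sum_a s a * ((i == a) != (j == a))%:R = s i + s j.
  rewrite -(sum_delta s i) -(sum_delta s j) -big_split /=; apply: eq_bigr => a _.
  rewrite (eq_sym i) (eq_sym j) -mulrDr; congr (_ * _).
  have [->|] := eqVneq a i; first by rewrite (negPf ij) addr0.
  by have [->|] := eqVneq a j; rewrite add0r.
have -> : \sum_(p : I * I) g p.1 p.2 * (cut2 p.1 p.2 i != cut2 p.1 p.2 j)%:R
   = 2 * r i + 2 * r j - 4 * g i j.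
  rewrite -(pair_bigA _ (fun a b => g a b * (cut2 a b i != cut2 a b j)%:R)) /=.
  have cutE a b : g a b * (cut2 a b i != cut2 a b j)%:R =
      g a b * (a == i)%:R + g a b * (b == i)%:R
      + (g a b * (a == j)%:R + g a b * (b == j)%:R)
      - 2 * (g a b * (b == j)%:R * (a == i)%:R + g a b * (b == i)%:R * (a == j)%:R).
    rewrite /cut2 /= !(eq_sym i) !(eq_sym j).
    have [<-|ab] := eqVneq a b; first by rewrite /g eqxx !mul0r; ring.
    have [ai|ai] := eqVneq a i; have [aj|aj] := eqVneq a j;
    have [bi|bi] := eqVneq b i; have [bj|bj] := eqVneq b j;
      first [by exfalso; move: ij ab; subst; rewrite ?eqxx | by rewrite /=; ring].
  have rowE a : \sum_b g a b * (cut2 a b i != cut2 a b j)%:R =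
      r a * (a == i)%:R + g a i + (r a * (a == j)%:R + g a j)
      - 2 * (g a j * (a == i)%:R + g a i * (a == j)%:R).
    under eq_bigr => b _ do rewrite cutE.
    rewrite sumrB !big_split /= -mulr_sumr big_split /= -!mulr_suml.
    by rewrite !sum_delta.
  under eq_bigr => a _ do rewrite rowE.
  rewrite sumrB !big_split /= -mulr_sumr big_split /= !sum_delta.
  have rsym k : \sum_a g a k = r k by apply: eq_bigr => a _; rewrite gsym.
  rewrite !rsym (gsym j i); ring.
rewrite /s /g (negPf ij); lra.
Qed.

End Approx.

(** The points x + h e_x are Ramsey, for orthonormal e_x in new dimensions: lines
    give the squares of the coordinates, up to a small error. *)
Lemma dist_ramsey_regularize (R : realType) (J : finType) n (Y : J -> 'rV[R]_n) h :
  0 < h -> dist_ramsey (fun i j => sqdist (Y i) (Y j) + h * (i != j)%:R).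
Proof.
move=> h0; apply: approx_regularize => //.
- by apply: approx_sum => k; exact: approx_sqr.
- by move=> i; rewrite sqdistxx.
- by move=> i j; rewrite sqdistC.
Qed.

(** * Extension of isometries *)

Section Extension.
Variable R : realType.

Lemma mulmx_trmx_eq0 m n (A : 'M[R]_(m, n)) : A *m A^T = 0 -> A = 0.
Proof.
move=> A0; apply/matrixP => i j; rewrite [RHS]mxE.
have /matrixP/(_ i i) := A0; rewrite !mxE => /eqP.
rewrite psumr_eq0 => [/allP H|k _]; last by rewrite mxE -expr2 sqr_ge0.
by have := H j (mem_index_enum _); rewrite mxE mulf_eq0 orbb => /eqP.
Qed.

(** C *m U is the orthogonal projection onto the row space of U. It exists because
    U and its Gram matrix have the same rank over an ordered field. *)
Lemma gram_projection m n (U : 'M[R]_(m, n)) : exists C : 'M[R]_(n, m),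
  (1%:M - C *m U) *m U^T = 0.
Proof.
exists (U^T *m pinvmx (U *m U^T)); rewrite mulmxBl mul1mx -(mulmxA _ U).
have sub : (U^T <= U *m U^T)%MS.
  rewrite submxE; apply/eqP.
  suff : (U^T *m cokermx (U *m U^T))^T = 0.
    by move/(congr1 trmx); rewrite trmxK trmx0.
  apply: mulmx_trmx_eq0.
  rewrite trmxK trmx_mul trmxK -mulmxA (mulmxA U) mulmx_coker mulmx0.
  by [].
by rewrite mulmxKpV // subrr.
Qed.

(** Equal distances give equal Gram matrices of the translates U and V to a common
    origin. Send the component in the row space of U to the corresponding
    combination of the rows of V, and keep the orthogonal component in m new
    dimensions. *)
Lemma isometry_extension (L : finType) m n (k : L -> 'rV[R]_m) (k' : L -> 'rV[R]_n) :
  (forall i j, sqdist (k' i) (k' j) = sqdist (k i) (k j)) ->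
  exists phi : 'rV[R]_m -> 'rV[R]_(n + m),
    (forall x y, sqdist (phi x) (phi y) = sqdist x y) /\
    (forall i, phi (k i) = row_mx (k' i) 0).
Proof.
move=> kk'.
have [l0 _|L0] := pickP (@predT L); last first.
  exists (row_mx 0); split=> [x y|i]; last by have := L0 i.
  by rewrite sqdist_row_mx sqdistxx add0r.
pose U := \matrix_(i < #|L|) (k (enum_val i) - k l0).
pose V := \matrix_(i < #|L|) (k' (enum_val i) - k' l0).
have polar q (a b c : 'rV[R]_q) :
    ((a - c) *m (b - c)^T) 0 0 = (sqdist a c + sqdist b c - sqdist a b) / 2.
  rewrite /sqdist mxE -big_split -sumrB mulr_suml /=; apply: eq_bigr => i _.
  by rewrite !mxE; field.
have rowE q (f g : 'I_#|L| -> 'rV[R]_q) i j :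
    ((\matrix_i f i) *m (\matrix_i g i)^T) i j = (f i *m (g j)^T) 0 0.
  by rewrite !mxE; apply: eq_bigr => l _; rewrite !mxE.
have gram : V *m V^T = U *m U^T.
  by apply/matrixP => i j; rewrite !rowE !polar !kk'.
have [C CU] := gram_projection U.
have UC : U *m (C *m U) = U.
  apply/esym/eqP; rewrite -subr_eq0 -[X in X - _]mulmx1 -mulmxBr; apply/eqP.
  apply: mulmx_trmx_eq0; set E := 1%:M - C *m U in CU *.
  rewrite trmx_mul mulmxA -(mulmxA U).
  have -> : E *m E^T = E.
    by rewrite {2}/E linearB /= trmx1 trmx_mul mulmxBr mulmx1 mulmxA CU mul0mx subr0.
  by rewrite -mulmxA CU mulmx0.
have VC : U *m (C *m V) = V.
  apply/eqP; rewrite -subr_eq0 -[X in _ - X]mul1mx mulmxA -mulmxBl; apply/eqP.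
  apply: mulmx_trmx_eq0; rewrite trmx_mul mulmxA -(mulmxA _ V) gram.
  have Z : (U *m C - 1%:M) *m U = 0.
    by rewrite mulmxBl mul1mx -mulmxA UC subrr.
  by rewrite (mulmxA _ U) Z !mul0mx.
have PP : (C *m U) *m (C *m U)^T = (C *m U)^T.
  apply/esym/eqP; rewrite -subr_eq0 -[X in X - _]mul1mx -mulmxBl trmx_mul mulmxA.
  by rewrite CU mul0mx.
have PT : (C *m U)^T = C *m U by have := congr1 trmx PP; rewrite trmx_mul !trmxK PP.
pose phi x := row_mx (k' l0 + (x - k l0) *m (C *m V))
                     ((x - k l0) *m (1%:M - C *m U)).
exists phi; split=> [x y|i].
  rewrite /phi sqdist_row_mx !sqdist_mulmx.
  have diff q (A : 'M_(m, q)) : (x - k l0) *m A - (y - k l0) *m A = (x - y) *m A.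
    by rewrite -mulmxBl opprB addrA subrK.
  rewrite opprD addrACA subrr add0r !diff; move: (x - y) => w.
  suff -> : w *m w^T = w *m (C *m V) *m (w *m (C *m V))^T
      + w *m (1%:M - C *m U) *m (w *m (1%:M - C *m U))^T by rewrite [RHS]mxE.
  have CVV : (C *m V) *m (C *m V)^T = C *m U.
    by rewrite trmx_mul mulmxA -(mulmxA C) gram -PT -[RHS]PP trmx_mul !mulmxA.
  have EE : (1%:M - C *m U) *m (1%:M - C *m U)^T = 1%:M - C *m U.
    by rewrite linearB /= trmx1 mulmxBr mulmx1 mulmxBl PP mul1mx subrr subr0.
  have conj q (A : 'M_(m, q)) : w *m A *m (w *m A)^T = w *m (A *m A^T) *m w^T.
    by rewrite trmx_mul !mulmxA.
  by rewrite !conj CVV EE -mulmxDl -mulmxDr addrC subrK mulmx1.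
have Ui q (f : L -> 'rV[R]_q) :
    row (enum_rank i) (\matrix_(i < #|L|) f (enum_val i)) = f i.
  by rewrite rowK enum_rankK.
rewrite /phi -(Ui _ (fun i => k i - k l0)) -/U -!row_mul VC mulmxBr mulmx1 UC.
by rewrite subrr row0 rowK enum_rankK addrC subrK.
Qed.
End Extension.

(** * Finite witnesses *)

Section Compactness.
Variable R : realType.

Lemma edist_sqdist m n (x y : 'rV[R]_m) (x' y' : 'rV[R]_n) :
  edist x y = edist x' y' <-> sqdist x y = sqdist x' y'.
Proof.
split=> [|e]; last by rewrite /edist -/(sqdist x y) e.
move/(congr1 (fun r => r ^+ 2)); rewrite /edist !sqr_sqrtr //; exact: sqdist_ge0.
Qed.

(** Compactness. If no finite F worked, each finite F would have a bad colouring
    chiF F; its limit along an ultrafilter refining the inclusion of finite sets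
    colours the whole space, and a monochromatic copy for the limit is one for
    some chiF F with F containing that copy. *)
Lemma Ramsey_dist_ramsey d (B : set 'rV[R]_d) (I : finType) (f : I -> 'rV[R]_d) :
  (forall i, B (f i)) -> Ramsey B ->
  dist_ramsey (fun i j => sqdist (f i) (f j)).
Proof.
move=> Bf [_ RB] C.
have [c0 _|C0] := pickP (@predT C); last first.
  by exists 0%N, unit, (fun=> 0) => chi; have := C0 (chi tt).
have [n Hn] := RB #|C| (introT card_gt0P (ex_intro _ c0 isT)).
apply: contrapT => noJ.
(* Colourings are made total, with default colour c0 off F. *)
have bad (F : seq 'rV[R]_n) : exists chi : 'rV[R]_n -> C,
    forall s : I -> 'rV[R]_n, (forall i, s i \in F) ->
    (forall i j, sqdist (s i) (s j) = sqdist (f i) (f j)) ->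
    ~ (forall i j, chi (s i) = chi (s j)).
  apply: contrapT => nochi; apply: noJ.
  exists n, (seq_sub F), val => chi0; apply: contrapT => nos; apply: nochi.
  exists (fun x => if insub x is Some y then chi0 y else c0) => s sF sd sm.
  apply: nos; exists (fun i => SeqSub (sF i)); split=> // i j.
  have insF l := insubT (fun x => x \in F) (sF l).
  by have := sm i j; rewrite !insF.
have [chiF HF] := choice bad.
pose U0 := filter_from setT
  (fun G : seq 'rV[R]_n => [set F : seq 'rV[R]_n | {subset G <= F}]).
have U0P : ProperFilter U0.
  apply: filter_from_proper; last by move=> G _; exists G => /=.
  apply: filter_from_filter; first by exists [::].
  move=> G H _ _; exists (G ++ H) => // F /= GHF; split=> x xG;
    by apply: GHF; rewrite mem_cat xG ?orbT.
have [U [UU U0U]] := ultraFilterLemma U0P.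
have Ux x : U [set F : seq 'rV[R]_n | x \in F].
  by apply: U0U; exists [:: x] => // F /= xF; apply: xF; rewrite mem_head.
have lim x : exists c, U [set F | chiF F x = c].
  apply: contrapT => noc.
  have H c : U [set F | chiF F x <> c].
    have [Uc|//] := in_ultra_setVsetC [set F | chiF F x = c] UU.
    by case: noc; exists c.
  have UN : U [set F | forall c, chiF F x <> c] by exact: filter_forall.
  have /filter_ex[F HFx] := UN.
  exact: (HFx (chiF F x)).
have [chi chiP] := choice lim.
have [T' [[phi [[phiT _ _] phid]] mono]] := Hn (fun x => enum_rank (chi x)).
have UA : U [set F : seq 'rV[R]_n | forall i,
    chiF F (phi (f i)) = chi (phi (f i)) /\ phi (f i) \in F].
  by apply: filter_forall => i; apply: filterI; [exact: chiP|exact: Ux].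
have /filter_ex[F FP] := UA.
apply: (HF F (phi \o f)) => [i|i j|i j]; first by have [] := FP i.
  by apply/edist_sqdist/phid.
have [-> _] := FP i; have [-> _] := FP j.
by apply: enum_rank_inj; apply: mono; apply: phiT.
Qed.

End Compactness.

(** * Adding an apex *)

Section Apex.
Variable R : realType.

(** The perpendicular is dropped onto the affine hull of the range of b: w is the
    component of z - b i0 orthogonal to all the differences b i - b i0. *)
Lemma exists_foot d (B : set 'rV[R]_d) (I : finType) (b : I -> 'rV[R]_d) (i0 : I) z :
  (forall i, B (b i)) -> ~ aff B z ->
  exists z0 h, 0 < h /\ forall i, sqdist (b i) z = sqdist (b i) z0 + h ^+ 2.
Proof.
move=> Bb zB.
pose U := \matrix_(i < #|I|) (b (enum_val i) - b i0).
have [C CU] := gram_projection U.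
pose w := (z - b i0) *m (1%:M - C *m U).
have wU : w *m U^T = 0 by rewrite -mulmxA CU mulmx0.
have w0 : w != 0.
  apply/eqP => w0; apply: zB.
  (* If w = 0, the coefficients c exhibit z as an affine combination. *)
  pose c := (z - b i0) *m C.
  have zE : z = b i0 + \sum_i c 0 i *: (b (enum_val i) - b i0).
    apply/eqP; rewrite addrC -subr_eq; apply/eqP.
    transitivity (c *m U).
      by apply/eqP; rewrite -subr_eq0 -mulmxA -{1}[z - _]mulmx1 -mulmxBr; apply/eqP.
    by rewrite mulmx_sum_row; apply: eq_bigr => i _; rewrite rowK.
  have splitR (j : 'I_#|I|) : fintype.split (rshift 1 j) = inr j := unsplitK (inr j).
  have splitL : fintype.split (lshift #|I| (@ord0 0)) = inl ord0 := unsplitK (inl _).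
  exists (1 + #|I|)%N,
    (fun i : 'I_(1 + #|I|) =>
       if fintype.split i is inr j then b (enum_val j) else b i0),
    (fun i : 'I_(1 + #|I|) =>
       if fintype.split i is inr j then c 0 j else 1 - \sum_j c 0 j); split.
  - by move=> i; case: fintype.split.
  - rewrite big_split_ord big_ord1 /= splitL.
    by under [X in _ + X = 1]eq_bigr do rewrite splitR; rewrite subrK.
  - rewrite big_split_ord big_ord1 /= splitL.
    under [X in _ = _ + X]eq_bigr do rewrite splitR.
    have {}zE : z = b i0 + (\sum_i c 0 i *: b (enum_val i) - (\sum_i c 0 i) *: b i0).
      rewrite [LHS]zE; congr (_ + _); rewrite scaler_suml -sumrB.
      by apply: eq_bigr => i _; rewrite scalerBr.
    rewrite [LHS]zE scalerBl scale1r addrA.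
    by rewrite addrAC.
have w_gt0 : 0 < (w *m w^T) 0 0.
  rewrite lt_def; apply/andP; split; last first.
    by rewrite mxE; apply: sumr_ge0 => i _; rewrite [w^T _ _]mxE -expr2 sqr_ge0.
  apply: contraNneq w0 => e; apply/eqP/mulmx_trmx_eq0.
  by apply/matrixP => i j; rewrite !ord1 e mxE.
exists (z - w), (Num.sqrt ((w *m w^T) 0 0)); split; first by rewrite sqrtr_gt0.
move=> i; rewrite sqr_sqrtr ?(ltW w_gt0) // !sqdist_mulmx.
pose v := b i - (z - w); rewrite -/v.
have -> : b i - z = v - w by rewrite /v opprB addrCA addrAC subrr add0r.
have wv : w *m v^T = 0.
  have -> : v = row (enum_rank i) U - (z - b i0) *m C *m U.
    rewrite rowK enum_rankK /v /w mulmxBr mulmx1 mulmxA.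
    by apply/rowP => j; move: (_ *m U) => p; rewrite !mxE; ring.
  rewrite linearB /= mulmxBr trmx_mul mulmxA wU mul0mx subr0.
  by rewrite rowE trmx_mul mulmxA wU mul0mx.
have vw : v *m w^T = 0 by rewrite -[LHS]trmxK trmx_mul trmxK wv trmx0.
clearbody v w.
by rewrite linearB /= mulmxBr !mulmxBl vw wv subr0 sub0r opprK mxE.
Qed.

(** The induction on the number of colours, with A the set of colours in use. In
    the step, E j is the private vector h e_j, [k (j, i)] is the point of K over
    p_j given by b i, and x j is the apex; x j and k (j, i) differ by h e_j and by
    z0 - b i in orthogonal directions. *)
Lemma dist_ramsey_apex d (I : finType) (b : I -> 'rV[R]_d) (i0 : I) z z0 h :
  0 < h -> (forall i, sqdist (b i) z = sqdist (b i) z0 + h ^+ 2) ->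
  dist_ramsey (fun i j => sqdist (b i) (b j)) ->
  dist_ramsey (fun o o' => sqdist (oapp b z o) (oapp b z o')).
Proof.
move=> h0 footP bR C.
suff H r : exists n (J : finType) (Y : J -> 'rV[R]_n),
    forall (chi : J -> C) (A : {set C}), (#|A| <= r)%N -> (forall j, chi j \in A) ->
    exists s : option I -> J,
      (forall o o', sqdist (Y (s o)) (Y (s o')) = sqdist (oapp b z o) (oapp b z o')) /\
      (forall o o', chi (s o) = chi (s o')).
  have [n [J [Y HY]]] := H #|C|; exists n, J, Y => chi.
  have [||s [Ys cs]] := HY chi finset.setT; rewrite ?cardsT //; last by exists s.
elim: r => [|r [n [J [Y HY]]]].
  exists 0%N, unit, (fun=> 0) => chi A; rewrite leqn0 cards_eq0 => /eqP -> H.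
  by have := H tt; rewrite inE.
have h2 : 0 < 2 * h ^+ 2 by rewrite mulr_gt0 // exprn_gt0.
pose E j : 'rV[R]_#|J| := h *: delta_mx 0 (enum_rank j).
have EE j j' : sqdist (E j) (E j') = 2 * h ^+ 2 * (j != j')%:R.
  rewrite sqdistZ; have [<-|jj'] := eqVneq j j'; first by rewrite sqdistxx !mulr0.
  rewrite /= mulr1 mulrC; congr (_ * _).
  have jj'r : enum_rank j != enum_rank j' by rewrite (inj_eq enum_rank_inj).
  rewrite /sqdist (bigD1 (enum_rank j)) //= (bigD1 (enum_rank j')) 1?eq_sym //= big1.
    by rewrite !mxE !eqxx (negPf jj'r) eq_sym (negPf jj'r) /=; ring.
  by move=> i /andP[/negPf ij /negPf ij']; rewrite !mxE ij ij' subrr expr0n.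
have E0 j : sqdist (E j) 0 = h ^+ 2.
  rewrite -(scaler0 _ h) sqdistZ (_ : sqdist _ _ = 1) ?mulr1 //.
  rewrite /sqdist (bigD1 (enum_rank j)) //= big1.
    by rewrite !mxE !eqxx /=; ring.
  by move=> i /negPf ij; rewrite !mxE ij subrr expr0n.
pose k (p : J * I) := row_mx (row_mx (Y p.1) (E p.1)) (b p.2).
pose x j := row_mx (row_mx (Y j) (0 : 'rV[R]_#|J|)) z0.
have kR : dist_ramsey (fun p q => sqdist (k p) (k q)).
  have := dist_ramseyD
    (dist_ramsey_pullback (fun p : J * I => p.1) (dist_ramsey_regularize Y h2))
    (dist_ramsey_pullback (fun p : J * I => p.2) bR).
  by apply: eq_dist_ramsey => p q; rewrite /k !sqdist_row_mx EE.
have [n' [J' [Y' HY']]] := kR C.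
(* The new witness: Y', together with a copy of the apices attached to every
   copy s of K in Y'. *)
pose iso (s : {ffun J * I -> J'}) :=
  forall p q, sqdist (Y' (s p)) (Y' (s q)) = sqdist (k p) (k q).
have ext s : exists phi : 'rV[R]_(n + #|J| + d) -> 'rV[R]_(n' + (n + #|J| + d)),
    iso s -> (forall u v, sqdist (phi u) (phi v) = sqdist u v) /\
             (forall p, phi (k p) = row_mx (Y' (s p)) 0).
  have [/isometry_extension[phi phiP]|] := pselect (iso s); first by exists phi.
  by exists (fun=> 0).
have [phi phiP] := choice ext.
exists _, (J' + {ffun J * I -> J'} * J)%type, (fun y => match y with
  | inl j' => row_mx (Y' j') 0 | inr (s, j) => phi s (x j) end) => chi A cardA chiA.
have [s0 [s0iso s0mono]] := HY' (fun j' => chi (inl j')).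
pose s := [ffun p => s0 p].
have siso : iso s by move=> p q; rewrite !ffunE s0iso.
have [phid phik] := phiP s siso.
have [/existsP[j /eqP jc]|none] :=
  boolP [exists j, chi (inr (s, j)) == chi (inl (s (j, i0)))].
  exists (fun o => if o is Some i then inl (s (j, i)) else inr (s, j)).
  have mixed i : sqdist (phi s (x j)) (row_mx (Y' (s (j, i))) 0) = sqdist (b i) z.
    rewrite -phik phid footP /x /k !sqdist_row_mx /= sqdistxx add0r.
    by rewrite (sqdistC 0) E0 (sqdistC z0) addrC.
  split.
    case=> [i|] [i'|] /=; rewrite ?sqdistxx ?mixed //.
    - rewrite sqdist_row_mx sqdistxx addr0 siso /k !sqdist_row_mx /=.
      by rewrite !sqdistxx !add0r.
    - by rewrite sqdistC mixed.
    - by rewrite sqdistC.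
  have all0 o : chi (if o is Some i then inl (s (j, i)) else inr (s, j))
      = chi (inl (s (j, i0))).
    by case: o => [i|//]; rewrite !ffunE; exact: s0mono.
  by move=> o o'; rewrite !all0.
have [j0 _|J0] := pickP (@predT J); last first.
  have [||t _] := HY (fun j => chi (inr (s, j))) finset.set0; first by rewrite cards0.
    by move=> j; have := J0 j.
  by have := J0 (t None).
(* No apex has the colour c of this copy of K. *)
pose c := chi (inl (s (j0, i0))).
have [||t [tiso tmono]] := HY (fun j => chi (inr (s, j))) (A :\ c).
- by have := cardsD1 c A; rewrite chiA /=; lia.
- move=> j; rewrite !inE chiA andbT; move: none; rewrite negb_exists => /forallP/(_ j).
  rewrite (_ : c = chi (inl (s (j, i0)))) //.
  by rewrite /c !ffunE; exact: s0mono.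
exists (fun o => inr (s, t o)); split=> o o'; last exact: tmono.
by rewrite phid /x !sqdist_row_mx !sqdistxx !addr0 tiso.
Qed.

End Apex.

Theorem theorem1p2 (R : realType) (d : nat) (B : set 'rV[R]_d) (z : 'rV[R]_d)
    (finB : finite_set B) (ramseyB : Ramsey B) (zB : ~ aff B z) :
  Ramsey (B `|` [set z]).
Proof.
split; first by rewrite finite_setU; split=> //; exact: finite_set1.
(* Without a point of B there is no foot; a single point is Ramsey in R^0. *)
have [B0|/set0P[b0 Bb0]] := eqVneq B set0.
  rewrite B0 set0U => r _; exists 0%N => chi; exists [set 0]; split.
    exists (fun=> 0); split; last first.
      by move=> x y -> ->; apply/edist_sqdist; rewrite !sqdistxx.
    split; [by [] | | by move=> _ ->; exists z].
    by move=> x y; rewrite !inE => -> ->.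
  by move=> x y -> ->.
have [bs BE] := (finite_seqP B).1 finB.
pose b (i : seq_sub bs) := val i.
have Bb i : B (b i) by rewrite BE /=; exact: valP.
have b0s : b0 \in bs by move: Bb0; rewrite BE.
have [z0 [h [h0 footP]]] := exists_foot (SeqSub b0s) Bb zB.
have TR := dist_ramsey_apex (SeqSub b0s) h0 footP (Ramsey_dist_ramsey Bb ramseyB).
move=> r r1; have [n [J [Y HY]]] := TR 'I_r.
exists n => chi; have [s [siso smono]] := HY (chi \o Y).
pose phi x := Y (s (insub x)).
have phid x y : (B `|` [set z]) x -> (B `|` [set z]) y ->
    sqdist (phi x) (phi y) = sqdist x y.
  have inv u : (B `|` [set z]) u -> oapp b z (insub u) = u.
    case=> [|->]; first by rewrite BE /= => ub; rewrite (insubT (fun u => u \in bs) ub).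
    by case: insubP.
  by move=> Bx By; rewrite siso !inv.
exists (phi @` (B `|` [set z])); split.
  exists phi; split; last by move=> x y Bx By; apply/edist_sqdist/phid.
  split; [by move=> x Bx; exists x|  |by []].
  move=> x y; rewrite !inE => Bx By exy; apply: sqdist_eq0.
  by rewrite -phid // exy sqdistxx.
by move=> _ _ [x _ <-] [y _ <-]; exact: smono.
Qed.
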